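(* Let $M$ be a metric space and let $X$ be one of the Banach spaces \[ \ell_\infty,\quad \Big(\bigoplus\nolimits_{2^{\omega}}\ell_\infty\Big)_{c_0},\quad \Big(\bigoplus\nolimits_{2^{\omega}}\ell_\infty\Big)_{\ell_1}. \] Then the following conditions are equivalent. (a) $(\operatorname{Lip}_0(M),w^* )$ is separable. (b) There is a bounded linear injection of $\mathcal F(M)$ into $X$. (c) There is a bounded linear injection of $\mathcal F(M)$ into $\mathcal F(X)$.
   Context: For a metric space $M$ with distinguished base point $0$ (the origin if $M$ is a Banach space), $\operatorname{Lip}_0(M)$ is the Banach space of real-valued Lipschitz functions $f$ on $M$ with $f(0)=0$, normed by the best Lipschitz constant. For $x\in M$, $\delta(x)\in \operatorname{Lip}_0(M)^*$ is evaluation at $x$; $\mathcal F(M)=\overline{\operatorname{span}}\{\delta(x):x\in M\}\subset \operatorname{Lip}_0(M)^*$ is the Lipschitz-free space, and $\mathcal F(M)^*=\operatorname{Lip}_0(M)$ isometrically. The $w^*$ topology on $\operatorname{Lip}_0(M)$ is the one induced by the predual $\mathcal F(M)$. $2^\omega$ is the cardinality of the continuum. $(\bigoplus_{2^{\omega}}\ell_\infty)_{c_0}$ and $(\bigoplus_{2^{\omega}}\ell_\infty)_{\ell_1}$ are the $c_0$-sum and the $\ell_1$-sum of $2^\omega$ many copies of $\ell_\infty=\ell_\infty(\mathbb N)$: families $(x_t)_{t\in 2^\omega}$ in $\ell_\infty$ such that $\{t:\|x_t\|\ge\varepsilon\}$ is finite for every $\varepsilon>0$, with norm $\sup_t\|x_t\|$,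 respectively families with norm $\sum_t\|x_t\|<\infty$. *)

(* Defs.v *)
From HB Require Import structures.
From mathcomp Require Import all_boot all_order all_algebra.
From mathcomp Require Import all_classical all_reals all_analysis.
Import Order.TTheory GRing.Theory Num.Theory.
Import numFieldNormedType.Exports.

Set Implicit Arguments.
Unset Strict Implicit.
Unset Printing Implicit Defensive.

Local Open Scope classical_set_scope.
Local Open Scope ring_scope.

Definition separable (T : topologicalType) : Prop :=
  exists2 D : set T, countable D & dense D.

Section best_const.
Context {R : realType} {I : Type}.
Implicit Types (a b : I -> R) (k : R).

Definition consts a b : set R := [set k | 0 <= k /\ forall i, a i <= k * b i].

(* If b >= 0 and some constant is admissible, the infimum is attained
   (best_constP), hence it is the least admissible constant. *)
Definition best_const a b : R := inf (consts a b).

Lemma best_const_ge0 a b : 0 <= best_const a b.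
Proof.
have [e|/set0P ne] := eqVneq (consts a b) set0.
  by rewrite /best_const e inf0.
by apply: lb_le_inf => // k [].
Qed.

Lemma best_const_le a b k : consts a b k -> best_const a b <= k.
Proof. by move=> abk; apply: ge_inf => //; exists 0 => ? []. Qed.

Lemma best_constP a b : (forall i, 0 <= b i) -> consts a b !=set0 ->
  forall i, a i <= best_const a b * b i.
Proof.
move=> b0 [k0 k0P] i; have [bi0|bi_neq0] := eqVneq (b i) 0.
  by have [_ /(_ i)] := k0P; rewrite bi0 !mulr0.
have bi_gt0 : 0 < b i by rewrite lt_neqAle eq_sym bi_neq0 b0.
rewrite -ler_pdivrMr//; apply: lb_le_inf; first by exists k0.
by move=> k [_ /(_ i)]; rewrite -ler_pdivrMr.
Qed.

End best_const.

Lemma norm_homog (R : realType) (V : lmodType R) (N : V -> R) :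
  (forall x, 0 <= N x) -> (forall l x, N (l *: x) <= `|l| * N x) ->
  forall l x, N (l *: x) = `|l| * N x.
Proof.
move=> N0 NZ l x; apply/eqP; rewrite eq_le NZ/=.
have [->|l0] := eqVneq l 0; first by rewrite normr0 mul0r.
rewrite -[X in N X](scalerK l0) -ler_pdivlMl ?normr_gt0// -normfV.
exact: NZ.
Qed.

Section bounded_linear.
Context {R : realType}.

Definition bounded_linear (V W : normedModType R) (f : V -> W) : Prop :=
  linear f /\ exists C : R, forall x, `|f x| <= C * `|x|.

Variable V : normedModType R.

Definition dual_pred : {pred V -> R} := fun f => `[< bounded_linear f >].

Lemma dual_predP f : reflect (bounded_linear f) (f \in dual_pred).
Proof. exact: asboolP. Qed.

Lemma dual_submod_closed : submod_closed dual_pred.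
Proof.
split=> [|a f g /dual_predP[lf [C Cf]] /dual_predP[lg [D Dg]]];
    apply/dual_predP; split.
- by move=> k x y; rewrite /= scaler0 addr0.
- by exists 0 => x; rewrite mul0r normr0.
- move=> k x y /=; rewrite [LHS](_ : _ = a *: f (k *: x + y) + g (k *: x + y))//.
  rewrite lf lg [RHS](_ : _ = k *: (a *: f x + g x) + (a *: f y + g y))//.
  by rewrite !scalerDr addrACA !scalerA mulrC.
- exists (`|a| * C + D) => x.
  rewrite (le_trans (ler_normD _ _))// mulrDl lerD// normrZ -mulrA.
  exact: ler_wpM2l.
Qed.

HB.instance Definition _ :=
  GRing.isSubmodClosed.Build R (V -> R) dual_pred dual_submod_closed.

Record dual := Dual { dual_fun :> V -> R ; _ : dual_fun \in dual_pred }.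

HB.instance Definition _ := [isSub for dual_fun].
HB.instance Definition _ := [Choice of dual by <:].
HB.instance Definition _ := [SubChoice_isSubLmodule of dual by <:].

(* The least C such that |phi x| <= C |x| for all x. *)
Definition op_norm (phi : dual) : R :=
  best_const (fun x => `|phi x|) (fun x => `|x|).

Lemma op_normP (phi : dual) x : `|phi x| <= op_norm phi * `|x|.
Proof.
apply: (@best_constP _ _ (fun x => `|phi x|) (fun x => `|x|)) => //.
case: phi => /= f /dual_predP[_ [C Cf]]; exists `|C|; split=> // y.
by rewrite (le_trans (Cf y))// ler_wpM2r// ler_norm.
Qed.

Lemma op_norm_le (phi : dual) (k : R) : 0 <= k ->
  (forall x, `|phi x| <= k * `|x|) -> op_norm phi <= k.
Proof. by move=> k0 kP; apply: best_const_le; split. Qed.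

Lemma op_norm_ge0 phi : 0 <= op_norm phi. Proof. exact: best_const_ge0. Qed.

Let op_normD (phi psi : dual) : op_norm (phi + psi) <= op_norm phi + op_norm psi.
Proof.
apply: op_norm_le => [|x]; first by rewrite addr_ge0// op_norm_ge0.
by rewrite (le_trans (ler_normD _ _))// mulrDl lerD// op_normP.
Qed.

Let op_normZ (l : R) (phi : dual) : op_norm (l *: phi) = `|l| * op_norm phi.
Proof.
apply: norm_homog l phi => [|l phi]; first exact: op_norm_ge0.
apply: op_norm_le => [|x]; first by rewrite mulr_ge0// op_norm_ge0.
by rewrite [leLHS]normrM -mulrA ler_wpM2l// op_normP.
Qed.

Let op_norm0_eq0 (phi : dual) : op_norm phi = 0 -> phi = 0.
Proof.
move=> n0; apply/val_inj/funext => x; apply/eqP.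
by rewrite -normr_le0 (le_trans (op_normP phi x))// n0 mul0r.
Qed.

HB.instance Definition _ :=
  Lmodule_isNormed.Build R dual op_normD op_normZ op_norm0_eq0.

End bounded_linear.

Section Lip0.
Context {R : realType} (M : metricType R) (o : M).

Definition Lipschitz (f : M -> R) : Prop :=
  exists C : R, forall x y, `|f x - f y| <= C * mdist x y.

Definition Lip0_pred : {pred M -> R} := fun f => `[< Lipschitz f /\ f o = 0 >].

Lemma Lip0_predP f : reflect (Lipschitz f /\ f o = 0) (f \in Lip0_pred).
Proof. exact: asboolP. Qed.

Lemma Lip0_submod_closed : submod_closed Lip0_pred.
Proof.
split=> [|a f g /Lip0_predP[[C Cf] fo] /Lip0_predP[[D Dg] go]];
    apply/Lip0_predP; split.
- by exists 0 => x y; rewrite mul0r subrr normr0.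
- by [].
- exists (`|a| * C + D) => x y.
  rewrite [X in `|X|](_ : _ = a * (f x - f y) + (g x - g y)); last first.
    by rewrite mulrBr addrACA -opprD.
  rewrite (le_trans (ler_normD _ _))// mulrDl lerD// normrM -mulrA.
  exact: ler_wpM2l.
- by rewrite [LHS](_ : _ = a * f o + g o)// fo go mulr0 addr0.
Qed.

HB.instance Definition _ :=
  GRing.isSubmodClosed.Build R (M -> R) Lip0_pred Lip0_submod_closed.

Record Lip0 := MkLip0 { Lip0_fun :> M -> R ; _ : Lip0_fun \in Lip0_pred }.

HB.instance Definition _ := [isSub for Lip0_fun].
HB.instance Definition _ := [Choice of Lip0 by <:].
HB.instance Definition _ := [SubChoice_isSubLmodule of Lip0 by <:].

(* The best Lipschitz constant: the least C such that
   |f x - f y| <= C d(x, y) for all x, y. *)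
Definition Lip_norm (f : Lip0) : R :=
  best_const (fun p : M * M => `|f p.1 - f p.2|) (fun p => mdist p.1 p.2).

Lemma Lip_normP (f : Lip0) x y : `|f x - f y| <= Lip_norm f * mdist x y.
Proof.
apply: (@best_constP _ _ (fun p : M * M => `|f p.1 - f p.2|)
  (fun p => mdist p.1 p.2) _ _ (x, y)) => [p|]; first exact: mdist_ge0.
case: f => /= f /Lip0_predP[[C Cf] _]; exists `|C|; split=> // -[u v] /=.
by rewrite (le_trans (Cf u v))// ler_wpM2r ?ler_norm// mdist_ge0.
Qed.

Lemma Lip_norm_le (f : Lip0) (k : R) : 0 <= k ->
  (forall x y, `|f x - f y| <= k * mdist x y) -> Lip_norm f <= k.
Proof. by move=> k0 kP; apply: best_const_le; split=> // -[]. Qed.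

Lemma Lip_norm_ge0 f : 0 <= Lip_norm f. Proof. exact: best_const_ge0. Qed.

Lemma Lip0_base (f : Lip0) : f o = 0.
Proof. by case: f => f /= /Lip0_predP[]. Qed.

Let Lip_normD (f g : Lip0) : Lip_norm (f + g) <= Lip_norm f + Lip_norm g.
Proof.
apply: Lip_norm_le => [|x y]; first by rewrite addr_ge0// Lip_norm_ge0.
rewrite [X in `|X|](_ : _ = (f x - f y) + (g x - g y)); last first.
  by rewrite addrACA -opprD.
by rewrite (le_trans (ler_normD _ _))// mulrDl lerD// Lip_normP.
Qed.

Let Lip_normZ (l : R) (f : Lip0) : Lip_norm (l *: f) = `|l| * Lip_norm f.
Proof.
apply: norm_homog l f => [|l f]; first exact: Lip_norm_ge0.
apply: Lip_norm_le => [|x y]; first by rewrite mulr_ge0// Lip_norm_ge0.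
rewrite [X in `|X|](_ : _ = l * (f x - f y)); last by rewrite mulrBr.
by rewrite normrM -mulrA ler_wpM2l// Lip_normP.
Qed.

Let Lip_norm0_eq0 (f : Lip0) : Lip_norm f = 0 -> f = 0.
Proof.
move=> n0; apply/val_inj/funext => x; apply/eqP.
by have := Lip_normP f x o; rewrite Lip0_base subr0 n0 mul0r normr_le0.
Qed.

HB.instance Definition _ :=
  Lmodule_isNormed.Build R Lip0 Lip_normD Lip_normZ Lip_norm0_eq0.

Lemma delta_subproof (x : M) : (fun f : Lip0 => f x) \in @dual_pred R Lip0.
Proof.
apply/dual_predP; split=> //; exists (mdist x o) => f.
by have := Lip_normP f x o; rewrite Lip0_base subr0 mulrC.
Qed.

Definition delta (x : M) : dual Lip0 := Dual (delta_subproof x).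

End Lip0.

Section linspan.
Context {R : realType} {V : lmodType R}.

Definition linspan (A : set V) : set V :=
  [set v | exists (n : nat) (a : 'I_n -> R) (x : 'I_n -> V),
     (forall i, A (x i)) /\ v = \sum_i a i *: x i].

Lemma linspan0 A : linspan A 0.
Proof. by exists 0%N, (fun=> 0), (fun=> 0); split; [case|rewrite big_ord0]. Qed.

Lemma linspanZD A a u v : linspan A u -> linspan A v -> linspan A (a *: u + v).
Proof.
move=> [n [b [x [Ax ->]]]] [m [c [y [Ay ->]]]].
exists (n + m)%N.
exists (fun i : 'I_(n + m) => match fintype.split i with inl j => a * b j | inr j => c j end).
exists (fun i : 'I_(n + m) => match fintype.split i with inl j => x j | inr j => y j end).
split=> [i|]; first by case: (fintype.split i).
rewrite big_split_ord scaler_sumr/=; congr +%R; apply: eq_bigr => i _.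
  by rewrite (unsplitK (inl _ i)) scalerA.
by rewrite (unsplitK (inr _ i)).
Qed.

End linspan.

Section free_space.
Context {R : realType} (M : metricType R) (o : M).

Definition free_pred : {pred dual (Lip0 o)} :=
  fun mu => `[< closure (linspan (range (delta o))) mu >].

Lemma free_predP mu :
  reflect (closure (linspan (range (delta o))) mu) (mu \in free_pred).
Proof. exact: asboolP. Qed.

Lemma closure_normP (V : normedModType R) (A : set V) (x : V) :
  closure A x <-> forall e : R, 0 < e -> exists2 a, A a & `|x - a| < e.
Proof.
split=> [cA e e0|H B].
  have [a [Aa]] := cA _ (nbhsx_ballx x e e0).
  by rewrite -ball_normE/= => xa; exists a.
rewrite -nbhs_ballE => -[e /= e0 eB]; have [a Aa xa] := H e e0.
by exists a; split=> //; apply: eB; rewrite -ball_normE.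
Qed.

Lemma free_submod_closed : submod_closed free_pred.
Proof.
split=> [|a f g /free_predP/closure_normP cf /free_predP/closure_normP cg];
    apply/free_predP.
  exact/subset_closure/linspan0.
apply/closure_normP => e e0.
have a1 : 0 < `|a| + 1 by rewrite ltr_wpDl.
have [f' sf' ff'] := cf (e / 2 / (`|a| + 1)) ltac:(by rewrite !divr_gt0).
have [g' sg' gg'] := cg (e / 2) ltac:(by rewrite divr_gt0).
exists (a *: f' + g'); first exact: linspanZD.
rewrite opprD addrACA -scalerBr (le_lt_trans (ler_normD _ _))//.
rewrite [ltRHS]splitr ler_ltD// normrZ.
rewrite (@le_trans _ _ ((`|a| + 1) * `|f - f'|))//.
  by rewrite ler_wpM2r// lerDl.
by rewrite -ler_pdivlMl// mulrC ltW.
Qed.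

HB.instance Definition _ := GRing.isSubmodClosed.Build R (dual (Lip0 o))
  free_pred free_submod_closed.

(* F(M), normed as a subspace of Lip_0(M)^*; o is the base point of M. *)
Record free_space :=
  FreeSpace { free_val :> dual (Lip0 o) ; _ : free_val \in free_pred }.

HB.instance Definition _ := [isSub for free_val].
HB.instance Definition _ := [Choice of free_space by <:].
HB.instance Definition _ := [SubChoice_isSubLmodule of free_space by <:].

Definition free_norm (mu : free_space) : R := `|free_val mu|.

Let free_normD (mu nu : free_space) :
  free_norm (mu + nu) <= free_norm mu + free_norm nu.
Proof. exact: ler_normD. Qed.

Let free_normZ (l : R) (mu : free_space) :
  free_norm (l *: mu) = `|l| * free_norm mu.
Proof. exact: normrZ. Qed.

Let free_norm0_eq0 (mu : free_space) : free_norm mu = 0 -> mu = 0.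
Proof. by move=> /normr0_eq0 mu0; apply: val_inj. Qed.

HB.instance Definition _ :=
  Lmodule_isNormed.Build R free_space free_normD free_normZ free_norm0_eq0.

(* Lip_0(M) with the w^* topology: the coarsest topology for which all the
   f |-> <mu, f>, mu in F(M), are continuous. *)
Definition Lip0_pairing (f : Lip0 o) : {ptws free_space -> R} := fun mu => mu f.

Definition Lip0_wstar : topologicalType := initial_topology Lip0_pairing.

End free_space.

Section normed_metric.
Context {R : realType} (X : normedModType R).

Definition normed_metric : Type := X.

HB.instance Definition _ := NormedModule.on normed_metric.

Let dist (x y : normed_metric) : R := `|x - y|.

Let dist_ge0 x y : 0 <= dist x y. Proof. exact: normr_ge0. Qed.

Let dist_positivity x y : dist x y = 0 -> x = y.
Proof. by move/normr0_eq0/eqP; rewrite subr_eq0 => /eqP. Qed.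

Let ballEdist x d : ball x d = [set y | dist x y < d].
Proof. by rewrite -ball_normE. Qed.

HB.instance Definition _ := PseudoMetric_isMetric.Build R normed_metric
  dist_ge0 dist_positivity ballEdist.

End normed_metric.

Section sup_norm.
Context {R : realType} {I : Type} {E : normedModType R}.
Implicit Types x y : I -> E.

Definition sup_norm x : R := sup (range (fun i => `|x i|)).

Lemma sup_norm_le x (k : R) : 0 <= k -> (forall i, `|x i| <= k) ->
  sup_norm x <= k.
Proof.
move=> k0 xk; have [e|/set0P ne] := eqVneq (range (fun i => `|x i|)) set0.
  by rewrite /sup_norm e sup0.
by apply: ge_sup => // _ [i _ <-].
Qed.

Lemma sup_normP x (C : R) : (forall i, `|x i| <= C) ->
  forall i, `|x i| <= sup_norm x.
Proof.
by move=> xC i; apply: ub_le_sup; [exists C => _ [j _ <-]|exists i].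
Qed.

Lemma sup_norm_ge0 x : 0 <= sup_norm x.
Proof.
have [hs|/sup_out e] := pselect (has_sup (range (fun i => `|x i|))); last first.
  by rewrite /sup_norm e.
case: hs => -[y xy] ub; apply: (@le_trans _ _ y); last exact: ub_le_sup.
by case: xy => i _ <-.
Qed.

End sup_norm.

Section ell_infty.
Context (R : realType).

Definition ell_infty_pred : {pred nat -> R} :=
  fun x => `[< exists C : R, forall n, `|x n| <= C >].

Lemma ell_infty_predP x :
  reflect (exists C : R, forall n, `|x n| <= C) (x \in ell_infty_pred).
Proof. exact: asboolP. Qed.

Lemma ell_infty_submod_closed : submod_closed ell_infty_pred.
Proof.
split=> [|a x y /ell_infty_predP[C Cx] /ell_infty_predP[D Dy]];
    apply/ell_infty_predP.
  by exists 0 => n; rewrite normr0.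
exists (`|a| * C + D) => n.
by rewrite (le_trans (ler_normD _ _))// lerD// normrZ ler_wpM2l.
Qed.

HB.instance Definition _ := GRing.isSubmodClosed.Build R (nat -> R)
  ell_infty_pred ell_infty_submod_closed.

Record ell_infty :=
  EllInfty { ell_infty_val :> nat -> R ; _ : ell_infty_val \in ell_infty_pred }.

HB.instance Definition _ := [isSub for ell_infty_val].
HB.instance Definition _ := [Choice of ell_infty by <:].
HB.instance Definition _ := [SubChoice_isSubLmodule of ell_infty by <:].

Definition ell_infty_norm (x : ell_infty) : R := sup_norm x.

Lemma ell_infty_normP (x : ell_infty) n : `|x n| <= ell_infty_norm x.
Proof. by case: x => /= x xP; have /ell_infty_predP[C /sup_normP] := xP. Qed.

Let ell_infty_norm_ge0 (x : ell_infty) : 0 <= ell_infty_norm x.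
Proof. exact: sup_norm_ge0. Qed.

Let ell_infty_normD (x y : ell_infty) :
  ell_infty_norm (x + y) <= ell_infty_norm x + ell_infty_norm y.
Proof.
apply: sup_norm_le => [|n]; first by rewrite addr_ge0.
by rewrite (le_trans (ler_normD _ _))// lerD// ell_infty_normP.
Qed.

Let ell_infty_normZ (l : R) (x : ell_infty) :
  ell_infty_norm (l *: x) = `|l| * ell_infty_norm x.
Proof.
apply: norm_homog l x => // l x; apply: sup_norm_le => [|n].
  by rewrite mulr_ge0.
by rewrite [leLHS]normrM ler_wpM2l// ell_infty_normP.
Qed.

Let ell_infty_norm0_eq0 (x : ell_infty) : ell_infty_norm x = 0 -> x = 0.
Proof.
move=> x0; apply/val_inj/funext => n; apply/eqP.
by rewrite -normr_le0 -x0 ell_infty_normP.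
Qed.

HB.instance Definition _ := Lmodule_isNormed.Build R ell_infty
  ell_infty_normD ell_infty_normZ ell_infty_norm0_eq0.

End ell_infty.

Section c0_sum.
Context {R : realType} (I : choiceType) (E : normedModType R).

Definition vanishing (x : I -> E) : Prop :=
  forall e : R, 0 < e -> finite_set [set t | e <= `|x t|].

Definition c0_pred : {pred I -> E} := fun x => `[< vanishing x >].

Lemma c0_predP x : reflect (vanishing x) (x \in c0_pred).
Proof. exact: asboolP. Qed.

Lemma c0_submod_closed : submod_closed c0_pred.
Proof.
split=> [|a x y /c0_predP cx /c0_predP cy]; apply/c0_predP => e e0.
  rewrite (_ : mkset _ = set0)//; apply/seteqP; split=> // t /= et.
  by have := lt_le_trans e0 et; rewrite normr0 ltxx.
have a1 : 0 < `|a| + 1 by rewrite ltr_wpDl.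
apply: (@sub_finite_set _ _ ([set t | e / 2 / (`|a| + 1) <= `|x t|] `|`
    [set t | e / 2 <= `|y t|])); last first.
  by rewrite finite_setU; split; [apply: cx|apply: cy]; rewrite !divr_gt0.
move=> t /= et; apply/orP; apply: contraTT et; rewrite negb_or -!ltNge.
move=> /andP[xt yt]; rewrite (le_lt_trans (ler_normD _ _))//.
rewrite [ltRHS]splitr ler_ltD// normrZ.
rewrite (@le_trans _ _ ((`|a| + 1) * `|x t|))//.
  by rewrite ler_wpM2r// lerDl.
by rewrite -ler_pdivlMl// mulrC ltW.
Qed.

HB.instance Definition _ := GRing.isSubmodClosed.Build R (I -> E)
  c0_pred c0_submod_closed.

Record c0_sum := C0Sum { c0_val :> I -> E ; _ : c0_val \in c0_pred }.

HB.instance Definition _ := [isSub for c0_val].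
HB.instance Definition _ := [Choice of c0_sum by <:].
HB.instance Definition _ := [SubChoice_isSubLmodule of c0_sum by <:].

Definition c0_norm (x : c0_sum) : R := sup_norm x.

Lemma c0_normP (x : c0_sum) t : `|x t| <= c0_norm x.
Proof.
suff [C xC] : exists C : R, forall t, `|x t| <= C by exact: (sup_normP xC).
case: x => /= x xP; have /c0_predP/(_ 1 ltr01)/finite_seqP[s sE] := xP.
exists (1 + \sum_(u <- s) `|x u|) => {}t.
have [xt|xt] := ltP `|x t| 1; first by rewrite ler_wpDr ?sumr_ge0// ltW.
have ts : [set` s] t by rewrite -sE.
rewrite ler_wpDl// (big_rem t)//= lerDl; exact: sumr_ge0.
Qed.

Let c0_norm_ge0 (x : c0_sum) : 0 <= c0_norm x.
Proof. exact: sup_norm_ge0. Qed.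

Let c0_normD (x y : c0_sum) : c0_norm (x + y) <= c0_norm x + c0_norm y.
Proof.
apply: sup_norm_le => [|t]; first by rewrite addr_ge0.
by rewrite (le_trans (ler_normD _ _))// lerD// c0_normP.
Qed.

Let c0_normZ (l : R) (x : c0_sum) : c0_norm (l *: x) = `|l| * c0_norm x.
Proof.
apply: norm_homog l x => // l x; apply: sup_norm_le => [|t].
  by rewrite mulr_ge0.
by rewrite [leLHS]normrZ ler_wpM2l// c0_normP.
Qed.

Let c0_norm0_eq0 (x : c0_sum) : c0_norm x = 0 -> x = 0.
Proof.
move=> x0; apply/val_inj/funext => t; apply/eqP.
by rewrite -normr_le0 -x0 c0_normP.
Qed.

HB.instance Definition _ :=
  Lmodule_isNormed.Build R c0_sum c0_normD c0_normZ c0_norm0_eq0.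

End c0_sum.

Section l1_sum.
Context {R : realType} (I : choiceType) (E : normedModType R).
Implicit Types x y : I -> E.

Definition norm_sum x : \bar R := \esum_(t in [set: I]) `|x t|%:E.

Definition l1_pred : {pred I -> E} := fun x => (norm_sum x < +oo)%E.

Let norm_sum_ge0 x : (0 <= norm_sum x)%E.
Proof. by apply: esum_ge0 => t _; rewrite lee_fin. Qed.

Let norm_sumD x y : (norm_sum (x + y)%R <= norm_sum x + norm_sum y)%E.
Proof.
rewrite /norm_sum -esumD; [|by move=> t _; rewrite lee_fin..].
by apply: le_esum => t _; rewrite -EFinD lee_fin ler_normD.
Qed.

Let norm_sumZ (a : R) x : (norm_sum (a *: x)%R <= `|a|%:E * norm_sum x)%E.
Proof.
apply: ub_ereal_sup => _ [A [finA _] <-].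
rewrite fsbig_finite//= (eq_bigr (fun t => `|a|%:E * `|x t|%:E)%E); last first.
  by move=> t _; rewrite -EFinM -normrZ.
rewrite -ge0_sume_distrr; last by move=> t _; rewrite lee_fin.
apply: lee_wpmul2l; first by rewrite lee_fin.
rewrite -fsbig_finite//; apply: ereal_sup_ubound; exists A => //.
Qed.

Lemma l1_submod_closed : submod_closed l1_pred.
Proof.
split=> [|a x y lx ly]; rewrite unfold_in.
  by rewrite /norm_sum esum1// => t _; rewrite normr0.
rewrite (le_lt_trans (norm_sumD _ _))// lte_add_pinfty//.
rewrite (le_lt_trans (norm_sumZ _ _))// lte_mul_pinfty// lee_fin//.
Qed.

HB.instance Definition _ := GRing.isSubmodClosed.Build R (I -> E)
  l1_pred l1_submod_closed.

Record l1_sum := L1Sum { l1_val :> I -> E ; _ : l1_val \in l1_pred }.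

HB.instance Definition _ := [isSub for l1_val].
HB.instance Definition _ := [Choice of l1_sum by <:].
HB.instance Definition _ := [SubChoice_isSubLmodule of l1_sum by <:].

Definition l1_norm (x : l1_sum) : R := fine (norm_sum x).

Lemma l1_normE (x : l1_sum) : (l1_norm x)%:E = norm_sum x.
Proof. by rewrite fineK// ge0_fin_numE//; case: x. Qed.

Let l1_norm_ge0 (x : l1_sum) : 0 <= l1_norm x.
Proof. exact: fine_ge0. Qed.

Let l1_normD (x y : l1_sum) : l1_norm (x + y) <= l1_norm x + l1_norm y.
Proof. by rewrite -lee_fin EFinD !l1_normE norm_sumD. Qed.

Let l1_normZ (l : R) (x : l1_sum) : l1_norm (l *: x) = `|l| * l1_norm x.
Proof.
by apply: norm_homog l x => // l x; rewrite -lee_fin EFinM !l1_normE norm_sumZ.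
Qed.

Let l1_norm0_eq0 (x : l1_sum) : l1_norm x = 0 -> x = 0.
Proof.
move=> x0; apply/val_inj/funext => t; apply/eqP.
rewrite -normr_le0 -lee_fin -x0 l1_normE.
apply: esum_ge; exists [set t]; first by split.
by rewrite fsbig_set1.
Qed.

HB.instance Definition _ :=
  Lmodule_isNormed.Build R l1_sum l1_normD l1_normZ l1_norm0_eq0.

End l1_sum.

Definition injects (R : realType) (V W : normedModType R) : Prop :=
  exists T : V -> W, bounded_linear T /\ injective T.

(* Main.v *)
Require Import Defs.
From mathcomp Require Import all_boot all_order all_algebra.
From mathcomp Require Import all_classical all_reals all_analysis.
From mathcomp Require Import ring lra.
Import Order.TTheory GRing.Theory Num.Theory.
Import numFieldNormedType.Exports.

(* (a) => (b): evaluation on a w^*-dense sequence, normalised, injects F(M) into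
   ell_infty, which is a summand of X.
   (b) => (c): given T : F(M) -> X, push F(M) forward along
   tau = T \o delta : M -> X.  Each bounded functional phi on X belongs to
   Lip_0(X) and satisfies <tau_# mu, phi> = phi (T mu), so tau_# mu = 0 forces
   T mu = 0, hence mu = 0.
   (c) => (a): each X carries a countable family of 1-Lipschitz functions that
   recovers the distance up to a constant; for the two sums these are built from
   suprema over cylinders of the Cantor set indexing the summands.  McShane
   extensions with rational data over such a family approximate any Lipschitz
   function on finite sets with uniformly bounded Lipschitz constants, so
   countably many of them separate the points of F(X).  Pulled back along
   F(M) -> F(X) they separate the points of F(M), and then their rational span
   is w^*-dense in Lip_0(M). *)

Set Implicit Arguments.
Unset Strict Implicit.
Unset Printing Implicit Defensive.

Local Open Scope classical_set_scope.
Local Open Scope ring_scope.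

(** * Rational approximation and bounded linear maps *)

Lemma exists_rat_near (R : realType) (x e : R) : 0 < e ->
  exists q : rat, `|x - ratr q| < e.
Proof.
move=> e0; have /rat_in_itvoo[q] : x - e < x + e by lra.
rewrite in_itv/= => /andP[xq qx]; exists q.
by rewrite ltr_distlC; apply/andP; split; lra.
Qed.

Section bounded_linear_theory.
Context {R : realType}.
Implicit Types V W : normedModType R.

Lemma bounded_linear_bound V W (f : V -> W) : bounded_linear f ->
  exists2 C : R, 0 <= C & forall x, `|f x| <= C * `|x|.
Proof.
move=> [_ [C fC]]; exists `|C| => // x.
by rewrite (le_trans (fC x))// ler_wpM2r// ler_norm.
Qed.

Lemma bounded_linear_comp (V W Z : normedModType R) (f : V -> W) (g : W -> Z) :
  bounded_linear f -> bounded_linear g -> bounded_linear (g \o f).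
Proof.
move=> bf bg; have [[lf _] [lg _]] := (bf, bg).
have [[C C0 fC] [D D0 gD]] := (bounded_linear_bound bf, bounded_linear_bound bg).
split=> [k x y|]; first by rewrite /= lf lg.
by exists (D * C) => x; rewrite (le_trans (gD _))// -mulrA ler_wpM2l.
Qed.

Lemma injects_trans (V W Z : normedModType R) :
  injects V W -> injects W Z -> injects V Z.
Proof.
move=> [f [bf fi]] [g [bg gi]]; exists (g \o f); split.
  exact: bounded_linear_comp.
exact: inj_comp.
Qed.

Lemma bounded_linear0 V W (f : V -> W) : bounded_linear f -> f 0 = 0.
Proof. by case=> lf _; have := lf (-1) 0 0; rewrite scaler0 addr0 scaleN1r addNr. Qed.

Lemma bounded_linearB V W (f : V -> W) x y :
  bounded_linear f -> f (x - y) = f x - f y.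
Proof. by case=> lf _; rewrite -scaleN1r addrC lf scaleN1r addrC. Qed.

Lemma bounded_linear_inj V W (f : V -> W) : bounded_linear f ->
  (forall x, f x = 0 -> x = 0) -> injective f.
Proof.
move=> bf f0 x y fxy; apply/eqP; rewrite -subr_eq0; apply/eqP/f0.
by rewrite bounded_linearB// fxy subrr.
Qed.

End bounded_linear_theory.

(** * Free spaces: point masses, duality with Lip_0, separating families *)

Section free_space_theory.
Context {R : realType} {M : metricType R} {o : M}.
Implicit Types (f g : Lip0 o) (mu nu : free_space o).

Lemma free_spaceP mu : bounded_linear (mu : Lip0 o -> R).
Proof. by case: (free_val mu) => f /= /dual_predP. Qed.

Lemma free_pairingZD a mu nu f : (a *: mu + nu) f = a * mu f + nu f.
Proof. by []. Qed.

Lemma free_pairingB mu f g : mu (f - g) = mu f - mu g.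
Proof. exact/bounded_linearB/free_spaceP. Qed.

Lemma ler_free_pairing mu f : `|mu f| <= `|mu| * `|f|.
Proof. exact: op_normP. Qed.

Lemma free_space_eq0 mu : (forall f, mu f = 0) -> mu = 0.
Proof. by move=> mu0; apply/val_inj/val_inj/funext. Qed.

Lemma delta_free_subproof (x : M) : delta o x \in @free_pred R M o.
Proof.
apply/free_predP/subset_closure; exists 1%N, (fun=> 1), (fun=> delta o x).
by split=> [_|]; [exists x|rewrite big_ord1 scale1r].
Qed.

Definition fdelta (x : M) : free_space o := FreeSpace (delta_free_subproof x).

Lemma ler_fdelta_dist (x y : M) : `|fdelta x - fdelta y| <= mdist x y.
Proof.
apply: op_norm_le => [|f]; first exact: mdist_ge0.
by rewrite mulrC; exact: Lip_normP.
Qed.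

Lemma fdelta_base : fdelta o = 0.
Proof. by apply: free_space_eq0 => f; exact: Lip0_base. Qed.

Lemma dual_sumE (V : normedModType R) n (F : 'I_n -> dual V) v :
  (\sum_i F i) v = \sum_i F i v.
Proof. by elim/big_ind2: _ => // ? x ? y <- <-. Qed.

Lemma free_sumE n (F : 'I_n -> free_space o) f :
  (\sum_i F i) f = \sum_i F i f.
Proof. by elim/big_ind2: _ => // ? x ? y <- <-. Qed.

Lemma free_approx mu (e : R) : 0 < e ->
  exists n (a : 'I_n -> R) (x : 'I_n -> M),
    `|mu - \sum_i a i *: fdelta (x i)| < e.
Proof.
move=> e0; have /free_predP/closure_normP/(_ e e0) := valP mu.
move=> [_ [n [a [y [yd ->]]]] lte]; have [x xy] : {x & forall i, delta o (x i) = y i}.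
  apply: (@choice _ _ (fun i x => delta o x = y i)) => i.
  by have [x _ <-] := yd i; exists x.
exists n, a, x; congr (_ < _): lte; congr (op_norm _); apply/val_inj.
apply/funext => f; rewrite /= [LHS](_ : _ = mu f - (\sum_i a i *: y i) f)//.
rewrite [RHS](_ : _ = mu f - (\sum_i a i *: fdelta (x i)) f)//.
rewrite free_sumE dual_sumE; congr (_ - _).
by apply: eq_bigr => i _; rewrite -xy.
Qed.

(** Finite combinations of point masses are norm dense, and both maps are continuous. *)
Lemma bounded_linear_fdelta_ext (W : normedModType R)
    (phi psi : free_space o -> W) :
  bounded_linear phi -> bounded_linear psi ->
  (forall x, phi (fdelta x) = psi (fdelta x)) -> phi =1 psi.
Proof.
move=> bphi bpsi eq_delta mu.
have [[lphi _] [lpsi _]] := (bphi, bpsi).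
have [C C0 phiC] := bounded_linear_bound bphi.
have [D D0 psiD] := bounded_linear_bound bpsi.
apply/eqP; rewrite -subr_eq0 -normr_le0; apply/ler_addgt0Pl => e e0.
have CD0 : 0 < C + D + 1 by rewrite ltr_wpDl// addr_ge0.
have [n [a [x]]] := @free_approx mu (e / (C + D + 1)) ltac:(by rewrite divr_gt0).
set nu := \sum_i _ => munu.
have eq_nu : phi nu = psi nu.
  rewrite /nu; elim/big_ind: _ => //; first by rewrite !bounded_linear0.
  - by move=> u v; rewrite -[u]scale1r lphi lpsi !scale1r => -> ->.
  - move=> i _; rewrite -[_ *: _]addr0 lphi lpsi eq_delta.
    by rewrite (bounded_linear0 bphi) (bounded_linear0 bpsi).
rewrite addr0 [X in `|X|](_ : _ = phi (mu - nu) - psi (mu - nu)); last first.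
  by rewrite !(@bounded_linearB _ _ _ _ mu nu)// eq_nu opprB addrA subrK.
rewrite (le_trans (ler_normB _ _))//.
apply: (@le_trans _ _ ((C + D + 1) * `|mu - nu|)); last first.
  by rewrite mulrC -ler_pdivlMr// ltW.
by rewrite !mulrDl -[leLHS]addr0 lerD ?mul1r// lerD.
Qed.

Lemma free_pairing_bounded_linear f :
  bounded_linear (fun mu : free_space o => mu f).
Proof.
split=> //; exists `|f| => mu.
by rewrite mulrC ler_free_pairing.
Qed.

(** The representing function is [phi \o fdelta], Lipschitz because [fdelta] is 1-Lipschitz. *)
Lemma free_dual_repr (phi : free_space o -> R) : bounded_linear phi ->
  exists f, forall mu, phi mu = mu f.
Proof.
move=> bphi; have [C C0 phiC] := bounded_linear_bound bphi.
have fP : phi \o fdelta \in @Lip0_pred R M o.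
  apply/Lip0_predP; split; last by rewrite /= fdelta_base bounded_linear0.
  exists C => x y /=; rewrite -bounded_linearB//.
  by rewrite (le_trans (phiC _))// ler_wpM2l// ler_fdelta_dist.
exists (MkLip0 fP); apply: bounded_linear_fdelta_ext => //.
exact: free_pairing_bounded_linear.
Qed.

(** The link between the three conditions: for a countable family it encodes w^*-density of the
    rational span. *)
Definition separating (J : Type) (f : J -> Lip0 o) :=
  forall mu, (forall j, mu (f j) = 0) -> mu = 0.

Lemma separating_injects (f : nat -> Lip0 o) :
  separating f -> injects (free_space o) (ell_infty R).
Proof.
(* The weights bound every coordinate by the norm of [mu]; adding 1 keeps them defined when [f n] is
   0. *)
move=> sepf; pose T0 mu n := (1 + `|f n|)^-1 * mu (f n).
have c0 n : 0 < 1 + `|f n| by rewrite ltr_pwDl.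
have T0le mu n : `|T0 mu n| <= `|mu|.
  rewrite normrM gtr0_norm ?invr_gt0// ler_pdivrMl//.
  rewrite (le_trans (ler_free_pairing _ _))// mulrC ler_wpM2r//.
  by rewrite lerDr.
have T0P mu : T0 mu \in @ell_infty_pred R.
  by apply/ell_infty_predP; exists `|mu| => n.
pose T mu := EllInfty (T0P mu).
have bT : bounded_linear T.
  split=> [k mu nu|].
    apply/val_inj/funext => n /=; rewrite /T0 free_pairingZD mulrDr.
    by rewrite mulrCA.
  by exists 1 => mu; rewrite mul1r; apply: (sup_norm_le (normr_ge0 _) (T0le mu)).
exists T; split=> //; apply: bounded_linear_inj => // mu Tmu0.
apply: sepf => n; have /(congr1 (fun x => ell_infty_val x n)) /= := Tmu0.
by move/eqP; rewrite mulf_eq0 gt_eqF ?invr_gt0//= => /eqP.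
Qed.

Lemma wstar_continuous_pairing mu :
  continuous (fun f : Lip0_wstar o => mu f).
Proof.
move=> f; apply: (@continuous_comp _ _ _
  (@Lip0_pairing R M o : Lip0_wstar o -> _) (proj mu)).
  exact: initial_continuous.
exact: proj_continuous.
Qed.

(** If [mu] is nonzero at some [f], the functions where it is nonzero form a nonempty w^*-open set,
    which meets the dense set. *)
Lemma separable_wstar_separating :
  separable (Lip0_wstar o) -> exists f : nat -> Lip0 o, separating f.
Proof.
move=> [D /countable_injP[i inj_i] dense_D].
(* Enumerate [D] by inverting the injection [i], with value 0 at integers that code nothing. *)
exists (fun n => xget 0 [set f | D f /\ i f = n]) => mu mu0.
apply: free_space_eq0 => f; apply: contrapT => /eqP muf.
have [g [/= mug Dg]] := dense_D [set f : Lip0_wstar o | mu f != 0]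
  ltac:(by exists f) (open_comp (fun x _ => @wstar_continuous_pairing mu x)
  (@open_neq R 0)).
move: (mu0 (i g)); case: xgetP => [_ -> [Dh /inj_i hg]|/(_ g)[]//].
by apply/eqP; rewrite hg// inE.
Qed.

(** * Density of rational spans in the w^* topology *)

Section rational_span.
Context {J : Type} (f : J -> Lip0 o).

Definition rat_comb (s : seq (rat * J)) : Lip0 o :=
  foldr (fun p g => ratr p.1 *: f p.2 + g) 0 s.

(* Induction on the list of functionals: if mu is nonzero on f j, subtracting
   suitable multiples of mu makes the remaining functionals vanish on f j, so
   that mu can be adjusted along f j without affecting them. *)
Lemma rat_comb_approx (g : Lip0 o) (l : seq (free_space o)) (e : R) :
  separating f -> 0 < e ->
  exists s, forall mu, mu \in l -> `|mu (rat_comb s - g)| < e.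
Proof.
move=> sepf; elim: {l}(size l) {-2}l (erefl (size l)) e => [|n IHn] [|mu l]//=.
  by move=> _ e e0; exists [::].
move=> [ln] e e0; have [mu0|] := pselect (forall j, mu (f j) = 0).
  have [s sP] := IHn l ln e e0; exists s => nu; rewrite inE => /orP[/eqP ->|/sP//].
  by rewrite (sepf _ mu0) [X in `|X|](_ : _ = 0)// normr0.
move=> /existsNP[j /eqP muj].
pose c nu := nu (f j) / mu (f j).
(* An error e/2/C at [mu] costs at most e/2 at each [nu]; the summand 1 keeps it below e at [mu]
   itself. *)
pose C := 1 + \sum_(nu <- l) `|c nu|.
have C1 : 1 <= C by rewrite lerDl sumr_ge0.
have C0 : 0 < C by exact: lt_le_trans C1.
have cC nu : nu \in l -> `|c nu| <= C.
  move=> nul; rewrite /C (big_rem nu)//= addrCA lerDl addr_ge0// sumr_ge0//.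
have e20 : 0 < e / 2 by rewrite divr_gt0.
(* These functionals vanish at [f j], so adding a multiple of [f j] to the combination leaves their
   values unchanged. *)
have [|s sP] := IHn [seq - c nu *: mu + nu | nu <- l] _ (e / 2) e20.
  by rewrite size_map.
have d0 : 0 < e / 2 / C by rewrite divr_gt0.
have m0 : 0 < `|mu (f j)| by rewrite normr_gt0.
have [q qP] := exists_rat_near (- mu (rat_comb s - g) / mu (f j)) (divr_gt0 d0 m0).
exists ((q, j) :: s).
have E nu : nu (rat_comb ((q, j) :: s) - g) =
    ratr q * nu (f j) + nu (rat_comb s - g).
  have [lnu _] := free_spaceP nu.
  by rewrite /= -addrA lnu.
have mule : `|mu (rat_comb ((q, j) :: s) - g)| < e / 2 / C.
  rewrite E [X in `|X|](_ : _ =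
    - (- mu (rat_comb s - g) / mu (f j) - ratr q) * mu (f j)).
    by rewrite normrM normrN -ltr_pdivlMr// normr_gt0.
  by field.
move=> nu; rewrite inE => /orP[/eqP ->|nul].
  rewrite (lt_le_trans mule)// ler_pdivrMr//.
  rewrite (@le_trans _ _ (e * 1))//; first lra.
  by rewrite ler_wpM2l// ltW.
rewrite [X in `|X|](_ : _ = (- c nu *: mu + nu) (rat_comb s - g) +
    c nu * mu (rat_comb ((q, j) :: s) - g)); last first.
  by rewrite !E free_pairingZD /c; field.
rewrite (le_lt_trans (ler_normD _ _))// [ltRHS]splitr ltr_leD//.
  by apply: sP; apply/mapP; exists nu.
rewrite normrM (@le_trans _ _ (C * (e / 2 / C)))//.
  by rewrite ler_pM// ?cC// ltW.
by rewrite mulrC divfK// gt_eqF.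
Qed.

End rational_span.

Lemma separating_separable_wstar (J : countType) (f : J -> Lip0 o) :
  separating f -> separable (Lip0_wstar o).
Proof.
move=> sepf; exists (range (rat_comb f)).
  exact: sub_countable (card_image_le _ _) (countableP _).
move=> O [g Og] [A oA AO].
(* Pairs of a finite list of functionals and a tolerance index a filter base of rational
   combinations near [g]. It converges pointwise to [g], and [rat_comb_approx] makes each member
   nonempty. *)
pose D (p : seq (free_space o) * R) := 0 < p.2.
pose B (p : seq (free_space o) * R) : set {ptws free_space o -> R} :=
  [set h | exists2 s, h = Lip0_pairing (rat_comb f s) &
     forall mu, mu \in p.1 -> `|mu (rat_comb f s - g)| < p.2].
have BF : Filter (filter_from D B).
  apply: filter_from_filter; first by exists ([::], 1); exact: ltr01.
  move=> [l e] [l' e'] /= De De'; exists (l ++ l', Num.min e e').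
    by rewrite /D/= lt_min; apply/andP.
  move=> _ [s -> sP]; split; exists s => // mu mul.
    by apply: (lt_le_trans (sP mu _)); rewrite ?mem_cat ?mul//= ge_min lexx.
  by apply: (lt_le_trans (sP mu _)); rewrite ?mem_cat ?mul ?orbT//= ge_min lexx orbT.
have : {ptws, filter_from D B --> Lip0_pairing g}.
  apply/pointwise_cvgP => mu; apply/cvgrPdist_lt => e e0 /=.
  exists ([:: mu], e) => // _ [s -> sP] /=.
  by rewrite distrC -free_pairingB; apply: sP; rewrite inE.
move=> /(_ A) []; first by apply: open_nbhs_nbhs; split=> //; rewrite -AO in Og.
move=> [l e] e0 BA; have [s sP] := rat_comb_approx g l sepf e0.
exists (rat_comb f s); split; last by exists s.
by rewrite -AO; apply: BA; exists s.
Qed.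

End free_space_theory.

Lemma ler_Lip0_dist (R : realType) (M : metricType R) (o : M) (f : Lip0 o) x y :
  `|f x - f y| <= `|f| * mdist x y.
Proof. exact: Lip_normP. Qed.

(** * Push-forward of free spaces along a Lipschitz map *)

Section pushforward.
Context {R : realType} {M N : metricType R} {o : M} {o' : N}.
Variables (tau : M -> N) (L : R).
Hypotheses (L0 : 0 <= L) (tauo : tau o = o')
  (tauL : forall x y, mdist (tau x) (tau y) <= L * mdist x y).

Lemma Lip0_comp_subproof (g : Lip0 o') : g \o tau \in @Lip0_pred R M o.
Proof.
apply/Lip0_predP; split; last by rewrite /= tauo Lip0_base.
exists (`|g| * L) => x y /=; rewrite (le_trans (ler_Lip0_dist _ _ _))//.
by rewrite -mulrA ler_wpM2l.
Qed.

Definition Lip0_comp (g : Lip0 o') : Lip0 o := MkLip0 (Lip0_comp_subproof g).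

Lemma ler_norm_Lip0_comp g : `|Lip0_comp g| <= L * `|g|.
Proof.
apply: Lip_norm_le => [|x y]; first by rewrite mulr_ge0.
rewrite (le_trans (ler_Lip0_dist g _ _))// (mulrC L) -mulrA ler_wpM2l//; exact: tauL.
Qed.

Lemma free_push_dual_subproof (mu : free_space o) :
  (fun g => mu (Lip0_comp g)) \in @dual_pred R (Lip0 o').
Proof.
apply/dual_predP; split; last first.
  exists (`|mu| * L) => g; rewrite (le_trans (ler_free_pairing _ _))// -mulrA.
  by rewrite ler_wpM2l// ler_norm_Lip0_comp.
move=> a g h; have [lmu _] := free_spaceP mu; rewrite -lmu.
by congr (mu _); apply/val_inj.
Qed.

Definition free_push_dual mu : dual (Lip0 o') := Dual (free_push_dual_subproof mu).

Lemma ler_norm_free_push_dual mu : `|free_push_dual mu| <= L * `|mu|.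
Proof.
apply: op_norm_le => [|g]; first by rewrite mulr_ge0.
rewrite (le_trans (ler_free_pairing _ _))// (mulrC L) -mulrA ler_wpM2l//.
exact: ler_norm_Lip0_comp.
Qed.

(** The adjoint of composition with [tau] is bounded and maps the point mass at x to the one at
    [tau x], so it respects the closed spans. *)
Lemma free_push_subproof mu : free_push_dual mu \in @free_pred R N o'.
Proof.
apply/free_predP/closure_normP => e e0.
have L1 : 0 < L + 1 by rewrite ltr_wpDl.
have [n [a [x]]] := @free_approx _ _ _ mu (e / (L + 1)) ltac:(by rewrite divr_gt0).
set nu := \sum_i _ => munu; exists (free_push_dual nu).
  exists n, a, (fun i => delta o' (tau (x i))).
  split; first by move=> i; exists (tau (x i)).
  apply/val_inj/funext => g; rewrite [RHS]dual_sumE.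
  rewrite [LHS](_ : _ = nu (Lip0_comp g))// free_sumE.
  exact: eq_bigr.
rewrite [X in `|X|](_ : _ = free_push_dual (mu - nu)); last by apply/val_inj.
rewrite (le_lt_trans (ler_norm_free_push_dual _))//.
rewrite (@le_lt_trans _ _ ((L + 1) * `|mu - nu|))//.
  by rewrite ler_wpM2r// lerDl.
by rewrite mulrC -ltr_pdivlMr.
Qed.

Definition free_push mu : free_space o' := FreeSpace (free_push_subproof mu).

Lemma free_push_bounded_linear : bounded_linear free_push.
Proof.
split=> [a mu nu|]; first by do 2!apply/val_inj.
by exists L => mu; exact: ler_norm_free_push_dual.
Qed.

End pushforward.

Lemma injects_free_normed (R : realType) (M : metricType R) (o : M)
    (X : normedModType R) :
  (forall x : X, x != 0 ->
     exists2 phi : X -> R, bounded_linear phi & phi x != 0) ->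
  injects (free_space o) X ->
  injects (free_space o) (free_space (0 : normed_metric X)).
Proof.
move=> sepX [T [bT injT]]; have [C C0 TC] := bounded_linear_bound bT.
pose tau : M -> normed_metric X := T \o fdelta (o := o).
have tauo : tau o = 0 by rewrite /tau/= fdelta_base bounded_linear0.
have tauC x y : mdist (tau x) (tau y) <= C * mdist x y.
  rewrite [leLHS](_ : _ = `|T (fdelta x) - T (fdelta y)|)//.
  rewrite -bounded_linearB// (le_trans (TC _))// ler_wpM2l//.
  exact: ler_fdelta_dist.
exists (free_push C0 tauo tauC); split; first exact: free_push_bounded_linear.
apply: bounded_linear_inj => [|mu push0]; first exact: free_push_bounded_linear.
apply: injT; rewrite (bounded_linear0 bT); apply/eqP; apply: contrapT => /negP Tmu.
have [phi bphi /eqP] := sepX _ Tmu; apply.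
have phiP : (phi : normed_metric X -> R) \in @Lip0_pred R (normed_metric X) 0.
  apply/Lip0_predP; split; last exact: (bounded_linear0 bphi).
  have [D _ phiD] := bounded_linear_bound bphi; exists D => x y.
  by rewrite -(bounded_linearB x y bphi) phiD.
(* Both sides are bounded linear in [mu] and agree on point masses. *)
have -> : phi (T mu) = mu (Lip0_comp tauo tauC (MkLip0 phiP)).
  apply: (bounded_linear_fdelta_ext (psi := fun mu => mu _) (phi := phi \o T)) => //.
    exact: bounded_linear_comp.
  exact: free_pairing_bounded_linear.
by have /(congr1 (fun nu : free_space (0 : normed_metric X) => nu (MkLip0 phiP))) := push0.
Qed.

(** Each [g j] pulls back along the injection to a bounded functional, hence to a Lipschitz
    function; injectivity carries separation over. *)
Lemma separable_wstar_of_injects (R : realType) (M N : metricType R) (o : M)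
    (o' : N) (J : countType) (g : J -> Lip0 o') :
  separating g -> injects (free_space o) (free_space o') ->
  separable (Lip0_wstar o).
Proof.
move=> sepg [S [bS injS]].
have /choice[f fP] : forall j, exists f : Lip0 o, forall mu, S mu (g j) = mu f.
  move=> j; apply: (@free_dual_repr _ _ _ (fun mu => S mu (g j))).
  exact: bounded_linear_comp bS (free_pairing_bounded_linear (g j)).
apply: (@separating_separable_wstar _ _ _ _ f) => mu muf; apply: injS.
by rewrite (bounded_linear0 bS); apply: sepg => j; rewrite fP.
Qed.

(** * Norming families and McShane extensions with rational data *)

Lemma ler_dist_max (R : realDomainType) (a b c d k : R) :
  `|a - c| <= k -> `|b - d| <= k -> `|Num.max a b - Num.max c d| <= k.
Proof.
rewrite !ler_distl => /andP[ca ac] /andP[db bd]; apply/andP; split.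
  by rewrite lerBlDr ge_max; apply/andP; split;
    rewrite -lerBlDr le_max ?ca ?db ?orbT.
by rewrite ge_max; apply/andP; split; rewrite -lerBlDr le_max !lerBlDr ?ac ?bd ?orbT.
Qed.

Section norming_family.
Context {R : realType} {M : metricType R} {J : countType}.
Implicit Types (f : M -> R) (l : seq (J * rat)) (s : seq (rat * seq (J * rat))).

Definition lipschitz_with (L : R) f :=
  forall x y, `|f x - f y| <= L * mdist x y.

(* When every phi j is 1-Lipschitz, phi is a bi-Lipschitz map into ell_infty(J). *)
Definition norming (phi : J -> M -> R) (c : R) := forall x y, x != y ->
  exists2 j, lipschitz_with 1 (phi j) & c * mdist x y <= `|phi j x - phi j y|.

Variables (phi : J -> M -> R) (c : R).
Hypotheses (c0 : 0 < c) (phic : norming phi c).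

(** A substitute for the distance to a point z, obtained when each rational in [l] is close to the
    corresponding [phi j z]. *)
Definition tent l x : R :=
  foldr (fun p => Num.max `|phi p.1 x - ratr p.2|) 0 l.

(* The constant - b%:R only makes the maximum over the empty list meaningful. *)
Definition mcshane (L b : nat) s x : R :=
  foldr (fun p => Num.max (ratr p.1 - L%:R * tent p.2 x)) (- b%:R) s.

Lemma tent_ge0 l x : 0 <= tent l x.
Proof. by elim: l => //= p l IH; rewrite le_max IH orbT. Qed.

(** Each point of [xs] other than z contributes one coordinate that tells it from z, with a rational
    within d of its value at z. *)
Lemma tent_approx (z : M) (xs : seq M) (d : R) : 0 < d ->
  exists l, [/\ lipschitz_with 1 (tent l), tent l z <= d &
    {in xs, forall x, c * mdist x z <= tent l x + d}].
Proof.
move=> d0; elim: xs => [|x xs [l [lL lz lx]]].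
  exists [::]; split=> //=; last exact: ltW.
  by move=> x y; rewrite subrr normr0 mul1r mdist_ge0.
have [xz|xz] := eqVneq x z.
  exists l; split=> // y; rewrite inE => /orP[/eqP ->|/lx//].
  by rewrite xz mdistxx mulr0 addr_ge0 ?tent_ge0// ltW.
have [j jL jxz] := phic xz; have [q qP] := exists_rat_near (phi j z) d0.
exists ((j, q) :: l); split=> /=.
- move=> u v; apply: ler_dist_max; last exact: lL.
  rewrite (le_trans (ler_dist_dist _ _))//.
  by rewrite [X in `|X|](_ : _ = phi j u - phi j v); [exact: jL|ring].
- by rewrite ge_max lz andbT ltW.
- move=> y; rewrite inE => /orP[/eqP ->|/lx ylx].
    rewrite (le_trans jxz)// (le_trans (ler_distD (ratr q) _ _))//.
    by rewrite lerD// ?le_max ?lexx// distrC ltW.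
  by rewrite (le_trans ylx)// lerD2r le_max lexx orbT.
Qed.

(** McShane's formula with tents in place of distances. Tents may shrink distances by the factor c,
    so a slope L above K / c is taken; it is fixed before the finite set and the accuracy. *)
Lemma mcshane_approx f (K : R) : 0 <= K -> lipschitz_with K f ->
  exists L : nat, forall (xs : seq M) (e : R), 0 < e ->
  exists b s, lipschitz_with L%:R (mcshane L b s) /\
    {in xs, forall x, `|mcshane L b s x - f x| <= e}.
Proof.
move=> K0 fK; exists (Num.bound (K / c)); set L := Num.bound _ => xs e e0.
have KL : K <= L%:R * c.
  by rewrite -ler_pdivrMr// ltW// archi_boundP// divr_ge0// ltW.
pose b := Num.bound (\sum_(x <- xs) `|f x|).
have bx x : x \in xs -> - b%:R <= f x.
  move=> xxs; rewrite lerNl (le_trans (ler_norm _))// normrN.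
  apply: (@le_trans _ _ (\sum_(x <- xs) `|f x|)).
    by rewrite (big_rem x)//= lerDl sumr_ge0.
  by rewrite ltW// archi_boundP// sumr_ge0.
exists b; suff [s [sL sf sx]] : exists s, [/\ lipschitz_with L%:R (mcshane L b s),
    {in xs, forall x, mcshane L b s x <= f x + e} &
    {in xs, forall x, f x - e <= mcshane L b s x}].
  exists s; split=> // x xxs; rewrite ler_distl; apply/andP; split.
    exact: sx.
  exact: sf.
have L0 : 0 <= L%:R :> R by [].
(* One d pays for rounding the value of [f], and L times d for the error of the tent. *)
have [d d0 dE] : exists2 d : R, 0 < d & (1 + L%:R) * d <= e.
  exists (e / (1 + L%:R)); first by rewrite divr_gt0// ltr_pwDl.
  by rewrite mulrC divfK// gt_eqF// ltr_pwDl.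
have : {subset xs <= xs} by [].
(* The upper bound is kept on all of [xs] throughout; the lower bound is gained one point at a
   time. *)
elim: {1 4}xs => [_|z zs IH sub].
  exists [::]; split=> //= [x y|x /bx xb].
    by rewrite subrr normr0 mulr_ge0// mdist_ge0.
  by rewrite (le_trans xb)// lerDl ltW.
have [|s [sL sf sx]] := IH; first by move=> x xzs; apply: sub; rewrite inE xzs orbT.
have [q qP] := exists_rat_near (f z) d0.
have [l [lL lz lx]] := tent_approx z xs d0.
move: qP; rewrite ltr_distl => /andP[q1 q2].
exists ((q, l) :: s); split=> /=.
- move=> u v; apply: ler_dist_max; last exact: sL.
  rewrite [X in `|X|](_ : _ = L%:R * (tent l v - tent l u)); last by ring.
  by rewrite normrM ger0_norm// distrC ler_wpM2l// (le_trans (lL _ _))// mul1r.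
- move=> x xxs; rewrite ge_max sf// andbT.
  have := fK x z; rewrite distrC ler_distl => /andP[_ fzx].
  have Llx : L%:R * (c * mdist x z) <= L%:R * (tent l x + d).
    by rewrite ler_wpM2l// lx.
  have := ler_wpM2r (mdist_ge0 x z) KL.
  move: dE fzx Llx q1 q2; rewrite mulrDr mulrDl mulrA; lra.
- move=> x; rewrite inE => /orP[/eqP ->|/sx xs']; last by rewrite le_max xs' orbT.
  rewrite le_max; apply/orP; left.
  have := ler_wpM2l L0 lz; move: dE q1 q2; rewrite mulrDl; lra.
Qed.

Variable o : M.

(* Indices for which mcshane is not Lipschitz are sent to 0. *)
Definition mcshane0 (p : nat * nat * seq (rat * seq (J * rat))) : Lip0 o :=
  insubd 0 (fun x => mcshane p.1.1 p.1.2 p.2 x - mcshane p.1.1 p.1.2 p.2 o).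

Lemma mcshane0E L b s : lipschitz_with L%:R (mcshane L b s) ->
  mcshane0 (L, b, s) = (fun x => mcshane L b s x - mcshane L b s o) :> (M -> R).
Proof.
move=> sL; rewrite /mcshane0 insubdK//; apply/Lip0_predP; split.
  exists L%:R => x y /=; rewrite [X in `|X|](_ : _ = mcshane L b s x - mcshane L b s y)//.
  by ring.
by rewrite subrr.
Qed.

(** With [nu] finitely supported near [mu] and [g] in the family, mu f = (mu - nu)(f - g) + nu (f -
    g). The first term is small since the norm of f - g is bounded independently of [nu], the second
    since [g] is close to [f] on the support. *)
Lemma norming_separating : separating mcshane0.
Proof.
move=> mu mu0; apply: free_space_eq0 => f.
have [L LP] := mcshane_approx (normr_ge0 f) (ler_Lip0_dist f).
apply/eqP; rewrite -normr_le0; apply/ler_addgt0Pl => e e0; rewrite addr0.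
have N0 : 0 < `|f| + L%:R + 1 by rewrite ltr_wpDl.
have [n [a [x]]] := @free_approx _ _ _ mu (e / 2 / (`|f| + L%:R + 1))
  ltac:(by rewrite !divr_gt0).
set nu := \sum_i _ => munu.
pose A := \sum_i `|a i| + 1.
have A0 : 0 < A by rewrite ltr_wpDl// sumr_ge0.
have d0 : 0 < e / 4 / A by rewrite !divr_gt0.
(* The base point is included because [mcshane0] subtracts the value there; this doubles the error
   to e/2/A. *)
have [b [s [sL sf]]] := LP (o :: [seq x i | i <- enum 'I_n]) _ d0.
set g := mcshane0 (L, b, s); have gE := mcshane0E sL.
have gL : `|g| <= L%:R.
  apply: Lip_norm_le => // u v; rewrite !gE.
  by rewrite [X in `|X|](_ : _ = mcshane L b s u - mcshane L b s v)//; ring.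
have so : `|mcshane L b s o| <= e / 4 / A.
  by have := sf o (mem_head _ _); rewrite Lip0_base subr0.
have gx i : `|(f - g) (x i)| <= e / 2 / A.
  rewrite [X in `|X|](_ : _ = f (x i) - g (x i))// gE distrC.
  rewrite [X in `|X|](_ : _ =
    (mcshane L b s (x i) - f (x i)) - mcshane L b s o); last by ring.
  rewrite (le_trans (ler_normB _ _))//.
  rewrite (_ : e / 2 / A = e / 4 / A + e / 4 / A); last by field; rewrite gt_eqF.
  by rewrite lerD// sf// inE map_f ?orbT// mem_enum.
rewrite [X in `|X|](_ : _ = (mu - nu) (f - g) + nu (f - g)); last first.
  rewrite [X in X + _](_ : _ = mu (f - g) - nu (f - g))// subrK.
  by rewrite free_pairingB mu0 subr0.
rewrite (le_trans (ler_normD _ _))// [leRHS]splitr lerD//.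
  rewrite (le_trans (ler_free_pairing _ _))//.
  apply: (@le_trans _ _ (`|mu - nu| * (`|f| + L%:R + 1))).
    by rewrite ler_wpM2l// (le_trans (ler_normB _ _))// ler_wpDr// lerD2l.
  by rewrite -ler_pdivlMr// ltW.
rewrite /nu free_sumE (le_trans (ler_norm_sum _ _ _))//.
apply: (@le_trans _ _ (\sum_i `|a i| * (e / 2 / A))).
  apply: ler_sum => i _; rewrite [X in `|X|](_ : _ = a i * (f - g) (x i))//.
  by rewrite normrM ler_wpM2l.
rewrite -mulr_suml -ler_pdivlMr ?divr_gt0// [leRHS](_ : _ = A).
  by rewrite lerDl.
by field; rewrite gt_eqF //= gt_eqF.
Qed.

End norming_family.

(** * Suprema over cylinders of the Cantor set *)

Lemma sup_norm_adherent (R : realType) (I : Type) (E : normedModType R)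
    (x : I -> E) (d : R) : 0 <= d -> d < sup_norm x -> exists i, d < `|x i|.
Proof.
move=> d0; apply: contraPP => /forallNP xd.
by apply/negP; rewrite -leNgt; apply: sup_norm_le => // i; rewrite leNgt; apply/negP.
Qed.

Lemma mkseq_separates (l : seq (nat -> bool)) t0 :
  exists N0, forall N, (N0 <= N)%N ->
    {in l, forall t, mkseq t N = mkseq t0 N -> t = t0}.
Proof.
elim: l => [|t l [N0 N0P]]; first by exists 0%N.
have [tt0|ntt0] := pselect (t = t0).
  exists N0 => N /N0P NP u; rewrite inE => /orP[/eqP ->//|]; exact: NP.
have [k tk] : exists k, t k <> t0 k.
  by apply/existsNP => tE; apply: ntt0; exact/funext.
exists (maxn N0 k.+1) => N; rewrite geq_max => /andP[/N0P NP kN] u.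
rewrite inE => /orP[/eqP ->|]; last exact: NP.
by move=> /(congr1 (nth false ^~ k)); rewrite !nth_mkseq.
Qed.

Section cylinder_sup.
Context {R : realType}.
Implicit Types (x y : (nat -> bool) -> ell_infty R) (s : seq bool).

Definition signed_part (b : bool) (r : R) : R := Num.max ((-1) ^+ b * r) 0.

Lemma signed_part_ge0 b r : 0 <= signed_part b r.
Proof. by rewrite le_max lexx orbT. Qed.

Lemma signed_partB b r r' : `|signed_part b r - signed_part b r'| <= `|r - r'|.
Proof.
apply: ler_dist_max; last by rewrite subrr normr0.
by rewrite -mulrBr normrM normr_sign mul1r.
Qed.

Lemma ler_norm_signed_part b r : `|signed_part b r| <= `|r|.
Proof.
have := signed_partB b r 0.
by rewrite subr0 {2}/signed_part mulr0 maxxx subr0.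
Qed.

(** A real is the difference of its two signed parts, so one of them accounts for half the gap. *)
Lemma signed_part_gap r r' :
  exists b, `|r - r'| / 2 <= `|signed_part b r - signed_part b r'|.
Proof.
have E (u : R) : u = signed_part false u - signed_part true u.
  rewrite /signed_part expr0 expr1 mul1r mulN1r.
  by rewrite !maxEle; case: (leP u 0) => ?; case: (leP (- u) 0) => ?; lra.
have : `|r - r'| <= `|signed_part false r - signed_part false r'| +
    `|signed_part true r - signed_part true r'|.
  rewrite (le_trans _ (ler_normB _ _))// {1}(E r) {1}(E r').
  by rewrite [X in `|X| <= _](_ : _ = signed_part false r - signed_part false r' -
    (signed_part true r - signed_part true r'))//; ring.
have [h|h] := leP (`|r - r'| / 2) `|signed_part false r - signed_part false r'|.
  by exists false.
by exists true; lra.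
Qed.

(** There are only countably many triples [(s, n, b)], although the summands are indexed by the
    whole Cantor set. As signed parts are nonnegative, the value 0 off the cylinder does not affect
    the supremum. *)
Definition cyl_sup s (n : nat) (b : bool) x : R :=
  sup_norm (fun t => if mkseq t (size s) == s then signed_part b (x t n) else 0).

Definition bounded_family x := exists C : R, forall t, `|x t| <= C.

Lemma ell_infty_coord_le (u : ell_infty R) n : `|u n| <= `|u|.
Proof. exact: ell_infty_normP. Qed.

Lemma cyl_sup_ge s n b x t : bounded_family x -> mkseq t (size s) = s ->
  signed_part b (x t n) <= cyl_sup s n b x.
Proof.
move=> [C xC] ts; rewrite -[leLHS]ger0_norm ?signed_part_ge0//.
pose F t := if mkseq t (size s) == s then signed_part b (x t n) else 0.
have FC u : `|F u| <= C.
  rewrite /F; case: ifP => _; last by rewrite normr0 (le_trans _ (xC u)).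
  rewrite (le_trans (ler_norm_signed_part _ _))//.
  by rewrite (le_trans (ell_infty_coord_le _ _)).
by have := sup_normP FC t; rewrite {1}/F ts eqxx.
Qed.

Lemma cyl_sup_le s n b x d : 0 <= d ->
  (forall t, mkseq t (size s) = s -> signed_part b (x t n) <= d) ->
  cyl_sup s n b x <= d.
Proof.
move=> d0 xd; apply: sup_norm_le => // t; case: eqP => [/xd|_].
  by rewrite ger0_norm// signed_part_ge0.
by rewrite normr0.
Qed.

Lemma cyl_sup_ge0 s n b x : 0 <= cyl_sup s n b x.
Proof. exact: sup_norm_ge0. Qed.

(** Only members of the cylinder enter the bound, so that disjoint cylinders can be added up in the
    l1 case. *)
Lemma cyl_sup_dist s n b x y d : 0 <= d -> bounded_family x -> bounded_family y ->
  (forall t, mkseq t (size s) = s -> `|x t - y t| <= d) ->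
  `|cyl_sup s n b x - cyl_sup s n b y| <= d.
Proof.
move=> d0; wlog: x y / cyl_sup s n b y <= cyl_sup s n b x => [W bx By xyd|yx bx By xyd].
  have [yx|/ltW xy] := leP (cyl_sup s n b y) (cyl_sup s n b x).
    exact: W yx bx By xyd.
  rewrite distrC; apply: W xy By bx _ => t ts; rewrite distrC; exact: xyd.
rewrite ger0_norm ?subr_ge0// lerBlDr; apply: cyl_sup_le => [|t ts].
  by rewrite addr_ge0// cyl_sup_ge0.
have xyt := signed_partB b (x t n) (y t n).
have xyn : `|x t n - y t n| <= d.
  by rewrite (le_trans _ (xyd t ts))//; exact: ell_infty_coord_le (x t - y t) n.
have := cyl_sup_ge n b By ts.
have := ler_norm (signed_part b (x t n) - signed_part b (y t n)); lra.
Qed.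

(** Finitely many [x t] have norm at least e; at a depth separating them from [t0], the rest of the
    cylinder contributes less than e. *)
Lemma cyl_sup_near x t0 e : bounded_family x -> vanishing x -> 0 < e ->
  exists N0, forall N, (N0 <= N)%N -> forall n b,
    `|cyl_sup (mkseq t0 N) n b x - signed_part b (x t0 n)| <= e.
Proof.
move=> bx vx e0; have /finite_seqP[l lE] := vx e e0.
have [N0 N0P] := mkseq_separates l t0; exists N0 => N /N0P NP n b.
rewrite ger0_norm ?subr_ge0; last by apply: cyl_sup_ge; rewrite // size_mkseq.
rewrite lerBlDr; apply: cyl_sup_le => [|t].
  by rewrite addr_ge0 ?signed_part_ge0// ltW.
rewrite size_mkseq => tN; have [tl|tl] := boolP (t \in l).
  by rewrite (NP t tl tN) lerDr ltW.
have xt : `|x t| < e.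
  rewrite ltNge; apply/negP => ext; have : [set` l] t by rewrite -lE.
  by rewrite /= (negbTE tl).
rewrite (le_trans (ler_norm _))// (le_trans (ler_norm_signed_part _ _))//.
rewrite (le_trans (ell_infty_coord_le _ _))// (le_trans (ltW xt))//.
by rewrite lerDl signed_part_ge0.
Qed.

(* On a cylinder small enough to isolate t0, the supremum only sees x t0. *)
Lemma cyl_sup_gap x y t0 : bounded_family x -> vanishing x ->
  bounded_family y -> vanishing y ->
  exists N0, forall N, (N0 <= N)%N -> exists n b,
    `|x t0 - y t0| / 8 <= `|cyl_sup (mkseq t0 N) n b x - cyl_sup (mkseq t0 N) n b y|.
Proof.
move=> bx vx By vy; have [xy0|] := eqVneq `|x t0 - y t0| 0.
  by exists 0%N => N _; exists 0%N, true; rewrite xy0 mul0r.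
rewrite -normr_gt0 normr_id; set D := `|_| => D0.
have [n xyn] : exists n, D / 2 < `|x t0 n - y t0 n|.
  apply: (sup_norm_adherent (x := ell_infty_val (x t0 - y t0))).
    by rewrite ltW// divr_gt0.
  by rewrite -[ltRHS]/D; lra.
have [b xyb] := signed_part_gap (x t0 n) (y t0 n).
(* Choosing n and then b leaves a gap of D/4; two errors of D/16 reduce it to D/8. *)
have e0 : 0 < D / 16 by rewrite divr_gt0.
have [N1 N1P] := cyl_sup_near t0 bx vx e0.
have [N2 N2P] := cyl_sup_near t0 By vy e0.
exists (maxn N1 N2) => N; rewrite geq_max => /andP[/N1P/(_ n b) NP1 /N2P/(_ n b) NP2].
exists n, b; set u := cyl_sup _ _ _ x in NP1 *; set v := cyl_sup _ _ _ y in NP2 *.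
set p := signed_part b (x t0 n) in xyb NP1 *.
set q := signed_part b (y t0 n) in xyb NP2 *.
have : `|p - q| <= `|u - v| + `|u - p| + `|v - q|.
  rewrite [X in `|X|](_ : _ = (u - v) - (u - p) + (v - q)); last by ring.
  by rewrite (le_trans (ler_normD _ _))// lerD2r ler_normB.
move: xyb xyn NP1 NP2; lra.
Qed.

End cylinder_sup.

(** * The space [ell_infty] *)

Section sequence_space.
Context {R : realType}.
Local Notation E := (ell_infty R).

Lemma ell_infty_norming :
  norming (fun (n : nat) (x : normed_metric E) => ell_infty_val x n) 2^-1.
Proof.
move=> x y xy; have D0 : 0 < `|x - y| by rewrite normr_gt0 subr_eq0.
have [n xyn] : exists n, `|x - y| / 2 < `|ell_infty_val x n - ell_infty_val y n|.
  apply: (sup_norm_adherent (x := ell_infty_val (x - y))).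
    by rewrite divr_ge0.
  by rewrite -[ltRHS]/(`|x - y|); lra.
exists n; last by rewrite mulrC ltW.
move=> u v; rewrite mul1r; exact: (ell_infty_coord_le (u - v)).
Qed.

Lemma ell_infty_coord_bounded_linear n : bounded_linear (fun x : E => x n).
Proof.
by split=> //; exists 1 => x; rewrite mul1r; exact: ell_infty_coord_le.
Qed.

Lemma ell_infty_neq0 (x : E) : x != 0 -> exists n, x n != 0.
Proof.
move=> x0; apply: contrapT => /forallNP xE; move/eqP: x0; apply.
by apply/val_inj/funext => n; have /negP := xE n; rewrite negbK => /eqP.
Qed.
End sequence_space.

(** * The c0-sum *)

Section c0_sum_of_ell_infty.
Context {R : realType}.
Local Notation E := (ell_infty R).
Local Notation C0 := (c0_sum (nat -> bool) E).

Lemma c0_coord_le (I : choiceType) (F : normedModType R) (x : c0_sum I F) t :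
  `|x t| <= `|x|.
Proof. exact: c0_normP. Qed.

Lemma c0_vanishing (x : C0) : vanishing x.
Proof. by case: x => x /= /c0_predP. Qed.

Lemma c0_bounded (x : C0) : bounded_family x.
Proof. by exists `|x| => t; exact: c0_coord_le. Qed.

Lemma c0_sum_norming : norming
  (fun (j : seq bool * nat * bool) (x : normed_metric C0) =>
     cyl_sup j.1.1 j.1.2 j.2 (c0_val x)) 16^-1.
Proof.
move=> x y xy; pose D := mdist x y; have D0 : 0 < D by rewrite mdist_gt0.
(* One summand carries half the distance, and a cylinder around it sees an eighth of that: hence
   1/16. *)
have [t xyt] : exists t, D / 2 < `|c0_val x t - c0_val y t|.
  apply: (sup_norm_adherent (x := c0_val (x - y))); first by lra.
  by rewrite -[ltRHS]/D; lra.
have [N /(_ N (leqnn N))[n [b gap]]] := cyl_sup_gap t (c0_bounded x)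
  (c0_vanishing x) (c0_bounded y) (c0_vanishing y).
exists (mkseq t N, n, b) => /=; last first.
  by rewrite -/D; move: gap xyt; lra.
move=> u v; rewrite mul1r.
apply: cyl_sup_dist; rewrite ?mdist_ge0//; try exact: c0_bounded.
by move=> t' _; exact: (c0_coord_le (u - v)).
Qed.

Lemma c0_coord_bounded_linear t : bounded_linear (fun x : C0 => x t).
Proof. by split=> //; exists 1 => x; rewrite mul1r; exact: c0_coord_le. Qed.

Lemma c0_functional_neq0 (x : C0) : x != 0 ->
  exists2 phi : C0 -> R, bounded_linear phi & phi x != 0.
Proof.
move=> x0; have [t xt] : exists t, x t != 0.
  apply: contrapT => /forallNP xE; move/eqP: x0; apply.
  by apply/val_inj/funext => t; have /negP := xE t; rewrite negbK => /eqP.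
have [n xtn] := ell_infty_neq0 xt.
exists ((fun y : E => y n) \o (fun x : C0 => x t)); last exact: xtn.
exact: bounded_linear_comp (c0_coord_bounded_linear t) (ell_infty_coord_bounded_linear n).
Qed.

Definition single (F : normedModType R) (u : F) (t : nat -> bool) : F :=
  if t == (fun=> false) then u else 0.

Lemma singleZD (F : normedModType R) a (u v : F) :
  single (a *: u + v) = a *: single u + single v.
Proof.
apply/funext => t; rewrite [RHS](_ : _ = a *: single u t + single v t)// /single.
by case: eqP; rewrite // scaler0 addr0.
Qed.

Lemma single_eq (F : normedModType R) (u : F) : single u (fun=> false) = u.
Proof. by rewrite /single eqxx. Qed.

Lemma injects_c0_sum : injects E C0.
Proof.
have sP (u : E) : single u \in @c0_pred R (nat -> bool) E.
  apply/c0_predP => e e0; apply: (@sub_finite_set _ _ [set (fun=> false)]) => //.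
  move=> t /=; rewrite /single; case: eqP => // _.
  by rewrite normr0 leNgt e0.
pose T u := C0Sum (sP u); have bT : bounded_linear T.
  split=> [a u v|]; first by apply/val_inj; exact: singleZD.
  exists 1 => u; rewrite mul1r; apply: sup_norm_le => // t /=; rewrite /single.
  by case: ifP; rewrite // normr0.
exists T; split=> // u v /(congr1 (fun x => c0_val x (fun=> false))) /=.
by rewrite !single_eq.
Qed.

End c0_sum_of_ell_infty.

(** * The l1-sum *)

Section l1_sum_of_ell_infty.
Context {R : realType}.
Local Notation E := (ell_infty R).
Local Notation L1 := (l1_sum (nat -> bool) E).

Lemma l1_esum (I : choiceType) (F : normedModType R) (x : l1_sum I F) :
  (`|x|%:E = \esum_(t in [set: I]) `|x t|%:E)%E.
Proof. exact: l1_normE. Qed.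

Lemma l1_sum_le (I : choiceType) (F : normedModType R) (x : l1_sum I F) (l : seq I) :
  uniq l -> \sum_(t <- l) `|x t| <= `|x|.
Proof.
move=> ul; rewrite -lee_fin l1_esum; apply: esum_ge.
exists [set` l]; first by split=> //; exact: finite_seq.
by rewrite -fsbig_seq// sumEFin.
Qed.

Lemma l1_sum_adherent (I : choiceType) (F : normedModType R) (x : l1_sum I F) (d : R) :
  d < `|x| -> exists2 l : seq I, uniq l & d < \sum_(t <- l) `|x t|.
Proof.
move=> dx; apply: contrapT => noL; move: dx; apply/negP; rewrite -leNgt.
rewrite -lee_fin l1_esum; apply: ge_ereal_sup => _ [A [finA _] <-].
rewrite fsbig_finite//= sumEFin lee_fin leNgt; apply/negP => dA; apply: noL.
by exists (finmap.enum_fset (fset_set A)).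
Qed.

Lemma l1_coord_le (I : choiceType) (F : normedModType R) (x : l1_sum I F) t :
  `|x t| <= `|x|.
Proof. by have := @l1_sum_le _ _ x [:: t]; rewrite big_seq1; apply. Qed.

Lemma l1_bounded (x : L1) : bounded_family x.
Proof. by exists `|x| => t; exact: l1_coord_le. Qed.

(** Outside a finite set whose partial sum is within e of the norm, a term of size e would push the
    sum past the norm. *)
Lemma l1_vanishing (x : L1) : vanishing x.
Proof.
move=> e e0; have [l ul ld] := @l1_sum_adherent _ _ x (`|x| - e) ltac:(lra).
apply: (@sub_finite_set _ _ [set` l]); last exact: finite_seq.
move=> t /= et; apply: contraTT et => tl; rewrite -ltNge.
by have := @l1_sum_le _ _ x (t :: l); rewrite /= tl ul big_cons => /(_ isT); lra.
Qed.

(** A depth together with, for each cylinder of that depth, a coordinate, a signed part and an outer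
    sign; finite functions keep the type countable. *)
Definition l1_index := {N : nat & {ffun N.-tuple bool -> nat * bool * bool}}.

Definition l1_test (j : l1_index) (x : normed_metric L1) : R :=
  \sum_s (-1) ^+ (tagged j s).2 *
    cyl_sup s (tagged j s).1.1 (tagged j s).1.2 (l1_val x).

(* The cylinders of a given depth are disjoint, so the variations of the
   suprema over them add up to at most the l1 norm. *)
Lemma l1_test_lipschitz j : lipschitz_with 1 (l1_test j).
Proof.
case: j => N k x y; rewrite mul1r [mdist _ _]/(`|x - y|) /l1_test -sumrB.
rewrite (le_trans (ler_norm_sum _ _ _))//.
(* The norm at [t] is charged to the only cylinder of depth [N] containing [t]. *)
pose w (t : nat -> bool) (s : N.-tuple bool) : R :=
  if mkseq t N == s then `|l1_val (x - y) t| else 0.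
have w0 t s : 0 <= w t s by rewrite /w; case: ifP.
have wle t : \sum_s w t s <= `|l1_val (x - y) t|.
  have tN : size (mkseq t N) == N by rewrite size_mkseq.
  rewrite (bigD1 (Tuple tN))//= big1 ?addr0; first by rewrite /w eqxx.
  by move=> s; rewrite /w -val_eqE/= eq_sym => /negbTE ->.
have esum_w : (\sum_s \esum_(t in [set: nat -> bool]) (w t s)%:E <= `|x - y|%:E)%E.
  rewrite -esum_sum; last by move=> t s _ _; rewrite lee_fin.
  rewrite l1_esum; apply: le_esum => t _.
  by rewrite sumEFin lee_fin.
have esum_w_fin s : (\esum_(t in [set: nat -> bool]) (w t s)%:E < +oo)%E.
  apply: (@le_lt_trans _ _ `|x - y|%:E); last exact: ltry.
  rewrite l1_esum; apply: le_esum => t _; rewrite lee_fin /w.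
  by case: ifP.
have esum_w_ge0 s : (0 <= \esum_(t in [set: nat -> bool]) (w t s)%:E)%E.
  by apply: esum_ge0 => t _; rewrite lee_fin.
rewrite -lee_fin (le_trans _ esum_w)// -sumEFin; apply: lee_sum => s _.
rewrite -mulrBr normrM normr_sign mul1r -[leRHS]fineK; last first.
  by rewrite ge0_fin_numE.
rewrite lee_fin; apply: cyl_sup_dist; [exact: fine_ge0|exact: l1_bounded..|].
move=> t; rewrite size_tuple => ts.
rewrite -lee_fin fineK ?ge0_fin_numE//; apply: esum_ge; exists [set t].
  by split.
by rewrite fsbig_set1 lee_fin /w ts eqxx.
Qed.

(** A finite [l] carries half the norm. At a common depth its points lie in distinct cylinders, each
    seeing an eighth of its point, and the outer signs make these contributions add up. *)
Lemma l1_sum_norming : norming l1_test 16^-1.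
Proof.
move=> x y xy; pose D := mdist x y; have D0 : 0 < D by rewrite mdist_gt0.
have [l ul ld] : exists2 l : seq (nat -> bool), uniq l &
    D / 2 < \sum_(t <- l) `|l1_val (x - y) t|.
  by apply: l1_sum_adherent; rewrite -[ltRHS]/D; lra.
have [N [Ngap Nsep]] : exists N,
    {in l, forall t, exists n b, `|l1_val (x - y) t| / 8 <=
      `|cyl_sup (mkseq t N) n b (l1_val x) - cyl_sup (mkseq t N) n b (l1_val y)|} /\
    {in l &, forall t u, mkseq t N = mkseq u N -> t = u}.
  have : forall l' : seq (nat -> bool), exists N0, forall N, (N0 <= N)%N ->
      forall t, t \in l' ->
      (exists n b, `|l1_val (x - y) t| / 8 <=
      `|cyl_sup (mkseq t N) n b (l1_val x) - cyl_sup (mkseq t N) n b (l1_val y)|) /\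
      {in l, forall u, mkseq u N = mkseq t N -> u = t}.
    elim=> [|t l' [N0 N0P]]; first by exists 0%N.
    have [N1 N1P] := cyl_sup_gap t (l1_bounded x) (@l1_vanishing x)
      (l1_bounded y) (@l1_vanishing y).
    have [N2 N2P] := @mkseq_separates l t.
    exists (maxn N0 (maxn N1 N2)) => N; rewrite !geq_max => /and3P[Nl' Nt Nt'] u.
    rewrite inE => /orP[/eqP ->|]; last exact: N0P.
    by split; [exact: N1P|exact: N2P].
  move=> /(_ l)[N /(_ N (leqnn N)) NP]; exists N; split; first by move=> t /NP[].
  by move=> t u tl ul' /((NP u ul').2 t tl).
pose dif s n b := cyl_sup s n b (l1_val x) - cyl_sup s n b (l1_val y).
(* The outer sign is that of the difference, so cylinders missing [l] contribute nonnegatively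
   too. *)
have /choice[k kP] : forall s : N.-tuple bool, exists k : nat * bool * bool,
    0 <= (-1) ^+ k.2 * dif s k.1.1 k.1.2 /\
    {in l, forall t, mkseq t N = s ->
      `|l1_val (x - y) t| / 8 <= (-1) ^+ k.2 * dif s k.1.1 k.1.2}.
  move=> s; have [[t tl ts]|nt] := pselect (exists2 t, t \in l & mkseq t N = s).
    have [n [b gap]] := Ngap t tl.
    exists (n, b, (dif s n b < 0)%R); rewrite /= -normrEsign; split=> // u ul' us.
    by rewrite (Nsep u t)// ?us// -ts.
  exists (0%N, true, (dif s 0%N true < 0)%R).
  rewrite /= -normrEsign; split=> // u ul' us.
  by exfalso; apply: nt; exists u.
exists (Tagged (fun N => {ffun N.-tuple bool -> nat * bool * bool}) [ffun s => k s]).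
  exact: l1_test_lipschitz.
rewrite -/D (le_trans _ (ler_norm _))// /l1_test/= -sumrB.
apply: (@le_trans _ _ (\sum_(t <- l) `|l1_val (x - y) t| / 8)).
  by rewrite -mulr_suml; move: ld; lra.
have tN (t : nat -> bool) : size (mkseq t N) == N by rewrite size_mkseq.
(* Group [l] by cylinder; each group has at most one point. *)
rewrite (partition_big (fun t => Tuple (tN t)) predT)//=.
apply: ler_sum => s _; rewrite !ffunE -mulrBr -/(dif _ _ _).
have [ks0 ksl] := kP s.
have [[t tl ts]|nt] := pselect (exists2 t, t \in l & mkseq t N = s).
  rewrite big_mkcond (bigD1_seq t)//= -val_eqE/= ts eqxx.
  rewrite big1_seq ?addr0; first exact: ksl.
  move=> u /= /andP[ut ul']; rewrite -val_eqE/=; case: eqP => // us.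
  by move/eqP: ut; case; apply: Nsep => //; rewrite us.
rewrite big1_seq// => u /= /andP[]; rewrite -val_eqE/= => /eqP us ul'.
by exfalso; apply: nt; exists u.
Qed.

Lemma l1_coord_bounded_linear t : bounded_linear (fun x : L1 => x t).
Proof. by split=> //; exists 1 => x; rewrite mul1r; exact: l1_coord_le. Qed.

Lemma l1_functional_neq0 (x : L1) : x != 0 ->
  exists2 phi : L1 -> R, bounded_linear phi & phi x != 0.
Proof.
move=> x0; have [t xt] : exists t, x t != 0.
  apply: contrapT => /forallNP xE; move/eqP: x0; apply.
  by apply/val_inj/funext => t; have /negP := xE t; rewrite negbK => /eqP.
have [n xtn] := ell_infty_neq0 xt.
exists ((fun y : E => y n) \o (fun x : L1 => x t)); last exact: xtn.
exact: bounded_linear_comp (l1_coord_bounded_linear t) (ell_infty_coord_bounded_linear n).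
Qed.

Lemma injects_l1_sum : injects E L1.
Proof.
have sE (u : E) : norm_sum (single u) = `|u|%:E.
  rewrite /norm_sum (esumID [set (fun=> false)])//.
  rewrite setTI esum_set1 ?lee_fin// single_eq esum1 ?adde0// => t [_ /eqP/negbTE tf].
  by rewrite /single tf normr0.
have sP (u : E) : single u \in @l1_pred R (nat -> bool) E.
  by rewrite unfold_in sE ltry.
pose T u := L1Sum (sP u); have bT : bounded_linear T.
  split=> [a u v|]; first by apply/val_inj; exact: singleZD.
  by exists 1 => u; rewrite mul1r -lee_fin l1_esum -[leLHS]/(norm_sum (single u)) sE.
exists T; split=> // u v /(congr1 (fun x => l1_val x (fun=> false))) /=.
by rewrite !single_eq.
Qed.

End l1_sum_of_ell_infty.

(** * The equivalence *)

Lemma injects_refl (R : realType) (V : normedModType R) : injects V V.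
Proof.
exists id; split=> //; split=> //.
by exists 1 => x; rewrite mul1r.
Qed.

(** Isolates what is used of X: a copy of [ell_infty] for (a) to (b), point-separating functionals
    for (b) to (c), a countable norming family for (c) to (a). *)
Lemma free_injection_equiv (R : realType) (M : metricType R) (o : M)
    (X : normedModType R) (J : countType) (phi : J -> normed_metric X -> R) (c : R) :
  injects (ell_infty R) X ->
  (forall x : X, x != 0 ->
     exists2 psi : X -> R, bounded_linear psi & psi x != 0) ->
  0 < c -> norming phi c ->
  [<-> separable (Lip0_wstar o);
       injects (free_space o) X;
       injects (free_space o) (free_space (0 : normed_metric X))].
Proof.
move=> ellX sepX c0 phic; tfae.
- move=> /separable_wstar_separating[f /separating_injects FM].
  exact: injects_trans FM ellX.
- exact: injects_free_normed.
- exact: separable_wstar_of_injects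
    (@norming_separating _ _ _ _ _ c0 phic (0 : normed_metric X)).
Qed.

Theorem corollary30 (R : realType) (M : metricType R) (o : M)
  (X : normedModType R)
  (hX : [\/ X = ell_infty R,
            X = c0_sum (nat -> bool) (ell_infty R) |
            X = l1_sum (nat -> bool) (ell_infty R)]) :
  [<-> separable (Lip0_wstar o);
       injects (free_space o) X;
       injects (free_space o) (free_space (0 : normed_metric X))].
Proof.
case: hX => ->.
- apply: free_injection_equiv (@injects_refl _ _) _ _ (ell_infty_norming (R := R)) => //.
  move=> x /ell_infty_neq0[n xn]; exists (fun x : ell_infty R => x n) => //.
  exact: ell_infty_coord_bounded_linear.
- apply: free_injection_equiv injects_c0_sum _ _ (c0_sum_norming (R := R)) => //.
  exact: c0_functional_neq0.
- apply: free_injection_equiv injects_l1_sum _ _ (l1_sum_norming (R := R)) => //.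
  exact: l1_functional_neq0.
Qed.
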